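(* Let $S$ be a $\sigma$-compact metric semigroup with identity $e$ satisfying Reiter's condition. Then $S$ has the Liouville property.
   Context: A metric semigroup is a semigroup with a metrizable topology for which multiplication is jointly continuous. For $a\in S$ and $f:S\to\mathbb C$, $(\delta_a*f)(x)=f(ax)$. $LUC(S)$ is the space of bounded continuous functions $f:S\to\mathbb C$ such that $a\in S\mapsto\delta_a*f\in C_b(S)$ is continuous for the supremum norm. For a Borel measure $\theta$ on $S$, $\delta_s*\theta$ is the pushforward of $\theta$ under $t\mapsto st$; $\|\cdot\|$ is the total variation norm. A probability measure $\pi$ on $S$ is tight if for every $\varepsilon>0$ there is a compact $K\subseteq S$ with $\pi(S\setminus K)<\varepsilon$. $S$ satisfies Reiter's condition if for every $\varepsilon>0$ and every compact $K\subseteq S$ there is a probability measure $\theta$ on $S$ with compact support such that $\|\theta-\delta_s*\theta\|<\varepsilon$ for all $s\in K$. For a probability measure $\pi$ on $S$, $H_\pi(S)=\{f\in LUC(S): f(x)=\int_Sf(xy)\,d\pi(y)\ \text{for all }x\in S\}$. $S$ has the Liouville property if there is a tight probability measure $\pi$ on $S$ such that $H_\pi(S)=\mathbb C\mathbf 1$ (the constant functions). *)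

(* Defs.v *)
From HB Require Import structures.
From mathcomp Require Import all_boot all_order all_algebra.
From mathcomp Require Import all_classical all_reals all_analysis.
From mathcomp Require Import complex.

Set Implicit Arguments.
Unset Strict Implicit.
Unset Printing Implicit Defensive.

Import Order.TTheory GRing.Theory Num.Theory.
Import numFieldNormedType.Exports.
Import ComplexField.Normc.

Local Open Scope classical_set_scope.
Local Open Scope ring_scope.
Local Open Scope complex_scope.

(* The metric is part of the structure, but only the topology that it induces
   is used in the definitions below. *)
HB.mixin Record Semigroup_isMetricSemigroup (R : realType) S
    & monoid.Semigroup S & Metric R S := {
  mulg_continuous : continuous (fun p : S * S => (p.1 * p.2)%g)
}.

#[short(type="metricSemigroupType")]
HB.structure Definition MetricSemigroup (R : realType) :=
  {S of monoid.Semigroup S & Metric R S & Semigroup_isMetricSemigroup R S}.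

#[short(type="metricMonoidType")]
HB.structure Definition MetricMonoid (R : realType) :=
  {S of monoid.Monoid S & MetricSemigroup R S}.

(* The library only equips pointed types with sigma-algebras. *)
HB.instance Definition _ (R : realType) (S : metricMonoidType R) :=
  isPointed.Build (MetricMonoid.sort S) 1%g.

Definition sigma_compact (T : topologicalType) : Prop :=
  exists2 K : (set T)^nat, (forall n, compact (K n)) & \bigcup_n K n = [set: T].

Definition borel (R : realType) (S : metricMonoidType R) : Type :=
  g_sigma_algebraType (@open S).
HB.instance Definition _ (R : realType) (S : metricMonoidType R) :=
  Measurable.on (borel S).

Section left_translation.
Context {R : realType} {S : metricMonoidType R}.

Definition lmul (s : S) : borel S -> borel S := fun t => (s * (t : S))%g.

Lemma lmul_continuous (s : S) : continuous (lmul s : S -> S).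
Proof.
move=> t; apply: (@continuous_comp S (S * S)%type S (fun t => (s, t))
  (fun p => (p.1 * p.2)%g)); last exact: mulg_continuous.
by apply: cvg_pair => //=; exact: cvg_cst.
Qed.

Lemma lmul_measurable (s : S) : measurable_fun [set: borel S] (lmul s).
Proof.
apply: (@measurability _ _ (borel S) (borel S) _ _ (@open S)) => //.
move=> _ [U oU <-]; rewrite setTI; apply: sub_sigma_algebra.
by have /continuousP := @lmul_continuous s; exact.
Qed.

HB.instance Definition _ (s : S) :=
  isMeasurableFun.Build _ _ (borel S) (borel S) (lmul s) (lmul_measurable s).

End left_translation.

Section measures.
Context {R : realType} {S : metricMonoidType R}.
Local Open Scope ereal_scope.

(* [|nu|(T)]; it does not depend on the Hahn decomposition that [cid] selects. *)
Definition tv_norm d (T : measurableType d) (nu : {charge set T -> \bar R}) :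
    \bar R :=
  let hahn := projT2 (cid (projT2 (cid (Hahn_decomposition nu)))) in
  charge_variation hahn [set: T].

(* [distribution theta (lmul s)] is the pushforward of [theta] under
   [t |-> s * t], that is, [delta_s * theta]. *)
Definition translation_defect (theta : probability (borel S) R) (s : S) :
    {charge set (borel S) -> \bar R} :=
  cadd (charge_of_finite_measure theta)
    (copp (charge_of_finite_measure (distribution theta (lmul s)))).

Definition measure_support (theta : probability (borel S) R) : set S :=
  [set x | forall U : set S, open U -> U x -> 0 < theta U].

Definition tight (pi : probability (borel S) R) : Prop :=
  forall eps : R, (0 < eps)%R ->
    exists2 K : set S, compact K & pi (~` K) < eps%:E.

End measures.

Definition Reiter_condition (R : realType) (S : metricMonoidType R) : Prop :=
  forall (eps : R) (K : set S), 0 < eps -> compact K ->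
    exists2 theta : probability (borel S) R,
      compact (measure_support theta) &
      forall s, K s -> (tv_norm (translation_defect theta s) < eps%:E)%E.

Section functions.
Context {R : realType} {S : metricMonoidType R}.
(* [R[i]^o] is [R[i]] with the topology given by its modulus. *)
Implicit Types f : S -> R[i]^o.

Definition delta_conv (a : S) f : S -> R[i]^o := fun x => f (a * x)%g.

Definition Cb : set (S -> R[i]^o) :=
  [set f : S -> R[i]^o | continuous f /\ exists M : R, forall x, normc (f x) <= M].

Definition sup_norm f : R := sup [set normc (f x) | x in [set: S]].

Definition LUC : set (S -> R[i]^o) :=
  [set f : S -> R[i]^o | [/\ Cb f, forall a, Cb (delta_conv a f) &
    forall a, sup_norm (delta_conv b f \- delta_conv a f) @[b --> a] --> 0]].

Definition cintegral (pi : probability (borel S) R) f : R[i] :=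
  (\int[pi]_y complex.Re (f y)) +i* (\int[pi]_y complex.Im (f y)).

Definition harmonic_LUC (pi : probability (borel S) R) : set (S -> R[i]^o) :=
  [set f : S -> R[i]^o | LUC f /\ forall x, f x = cintegral pi (fun y => f (x * y)%g)].

End functions.

Definition Liouville_property (R : realType) (S : metricMonoidType R) : Prop :=
  exists2 pi : probability (borel S) R,
    tight pi & harmonic_LUC pi = range (fun c : R[i]^o => cst c).

(* Main.v *)
From HB Require Import structures.
Require Import Defs.
From mathcomp Require Import all_boot all_order all_algebra.
From mathcomp Require Import all_classical all_reals all_analysis.
From mathcomp Require Import measurable_realfun complex.

(** The measure is built as in the Kaimanovich-Vershik and Rosenblatt argument:
    [pi = \sum_k 2^-(k+1) theta_k], where [theta_k] is almost invariant, with
    error [1/(k+1)], under translation by a compact set [K_k]. The sets [K_k]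
    increase, and each is chosen so large that for [x] in a compact set [C_k]
    from an exhaustion of [S] it contains every product [x y_1 ... y_j] with
    [j <= N_k] and all [y_i] in the supports of [theta_0, ..., theta_(k-1)].
    The number [N_k] is such that [(1 - 2^-k)^N_k <= 1/(k+1)]: among [N_k]
    independent draws of an index according to the weights [2^-(i+1)], it is
    very likely that one is at least [k].

    A harmonic [g] with [0 <= g <= B] is compared at two points [x] and [x'] of
    [C_m] by expanding it step by step with [g x = \int g (x y) dpi y]. As long
    as the index drawn is below [m], the same factor [y] is appended to both
    points and the comparison goes on; the first time the index is some
    [k >= m], both points still lie in [K_m `<=` K_k], so the two integrals
    against [theta_k] differ by at most [2 B / (k+1)]. The case where no index
    reaches [m] within [N_m] steps has probability at most [1/(m+1)] and costs
    at most [B] ([harmonic_contraction]). Hence [g x <= g x' + 3 B / (m+1)] for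
    all large [m], and [g] is constant. Organising the estimate pointwise in
    this way replaces convolution powers of [pi] by an induction on the number
    of steps.

    Three facts about measures support this: an almost invariant measure gives
    almost invariant integrals of bounded functions ([le_integral_tv_norm]); the
    support carries the whole mass in a sigma-compact metric space
    ([measure_supportC_null]); and every probability on such a space is tight
    ([sigma_compact_tight]). A complex harmonic function is treated through its
    real and imaginary parts, shifted so as to be nonnegative. *)

Set Implicit Arguments.
Unset Strict Implicit.
Unset Printing Implicit Defensive.

Import Order.TTheory GRing.Theory Num.Theory.
Import numFieldNormedType.Exports.
Import ComplexField.Normc.

Local Open Scope classical_set_scope.
Local Open Scope ring_scope.

(** * Total variation and integrals of bounded functions *)

Section total_variation.
Context d (T : measurableType d) (R : realType).
Local Open Scope ereal_scope.

(** With [nu = nu+ - nu-] the Jordan decomposition, [P + nu- = Q + nu+] as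
    measures, and integrating [g] against [nu+] or [nu-] costs at most
    [B * |nu|(T)]. Phrasing it with an identity between sums of positive
    measures keeps all integrals nonnegative. *)
Lemma le_integral_tv_norm (P Q : {finite_measure set T -> \bar R})
    (nu : {charge set T -> \bar R}) (g : T -> R) (B : R) :
  (forall A, measurable A -> nu A = P A - Q A) ->
  measurable_fun [set: T] g -> (forall x, 0 <= g x <= B)%R ->
  \int[P]_x (g x)%:E <= \int[Q]_x (g x)%:E + B%:E * tv_norm nu /\
  \int[Q]_x (g x)%:E <= \int[P]_x (g x)%:E + B%:E * tv_norm nu.
Proof.
move=> nuE mg gB.
have mEg : measurable_fun [set: T] (EFin \o g) by exact/measurable_EFinP.
have g0 x : 0 <= (g x)%:E by rewrite lee_fin; case/andP: (gB x).
rewrite /tv_norm.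
move: (projT2 (cid (projT2 (cid (Hahn_decomposition nu))))) => hahn.
pose pos : {measure set T -> \bar R} := jordan_pos hahn.
pose neg : {measure set T -> \bar R} := jordan_neg hahn.
have bound (m : {measure set T -> \bar R}) :
    m [set: T] <= charge_variation hahn [set: T] ->
    \int[m]_x (g x)%:E <= B%:E * charge_variation hahn [set: T].
  move=> mT; apply: (@le_trans _ _ (\int[m]_x (cst B%:E x))).
    apply: ge0_le_integral => //.
    by move=> x _; rewrite lee_fin; case/andP: (gB x).
  rewrite integral_cst// lee_wpmul2l// lee_fin.
  by case/andP: (gB point) => /le_trans; exact.
have E : \int[P]_x (g x)%:E + \int[neg]_x (g x)%:E =
         \int[Q]_x (g x)%:E + \int[pos]_x (g x)%:E.
  rewrite -!ge0_integral_measure_add//.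
  apply: eq_measure_integral => A mA _.
  rewrite /= /msum !big_ord_recl !big_ord0 /= !adde0.
  rewrite -[LHS]/(P A + neg A) -[RHS]/(Q A + pos A).
  have : P A - Q A = pos A - neg A.
    by rewrite -nuE// (jordan_decomp hahn mA) /cadd/= cscaleN1.
  have fP : P A \is a fin_num by exact: fin_num_measure.
  have fQ : Q A \is a fin_num by exact: fin_num_measure.
  have fp : pos A \is a fin_num by exact: fin_num_measure.
  have fn : neg A \is a fin_num by exact: fin_num_measure.
  move: fP fQ fp fn; case: (P A) => [p| |]//; case: (Q A) => [q| |]//.
  case: (pos A) => [a| |]//; case: (neg A) => [b| |]// _ _ _ _.
  rewrite -!EFinB -!EFinD => -[/eqP]; rewrite subr_eq => /eqP ->.
  by rewrite addrAC subrK addrC.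
split.
- apply: (@le_trans _ _ (\int[P]_x (g x)%:E + \int[neg]_x (g x)%:E)).
    by rewrite leeDl// integral_ge0.
  by rewrite E leeD2l// bound// leeDl.
- apply: (@le_trans _ _ (\int[Q]_x (g x)%:E + \int[pos]_x (g x)%:E)).
    by rewrite leeDl// integral_ge0.
  by rewrite -E leeD2l// bound// leeDr.
Qed.

End total_variation.

(** * Borel probabilities on a sigma-compact metric monoid *)

Section borel_measures.
Context {R : realType} {S : metricMonoidType R}.
Implicit Types (theta : probability (borel S) R) (K U : set S).

Lemma borel_open U : open U -> measurable (U : set (borel S)).
Proof. exact: sub_sigma_algebra. Qed.

Lemma borel_closed U : closed U -> measurable (U : set (borel S)).
Proof.
move=> cU; rewrite -(setCK U); apply: measurableC; apply: borel_open.
exact: closed_openC.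
Qed.

Lemma continuous_borel_measurable (f : S -> R) :
  continuous f -> measurable_fun [set: borel S] (f : borel S -> R).
Proof.
move=> /continuousP cf; apply: (measurability _ (RGenOpens.measurableE R)).
move=> _ [_ [a [b ->] <-]]; rewrite setTI; apply: borel_open.
exact/cf/interval_open.
Qed.

Lemma sigma_compact_exhaustion : sigma_compact S ->
  exists C : (set S)^nat, [/\ forall n, compact (C n),
    forall m n, (m <= n)%N -> C m `<=` C n & forall x, exists n, C n x].
Proof.
move=> [K cK KT]; exists (fun n => \big[setU/set0]_(i < n) K i); split.
- by move=> n; apply: bigsetU_compact.
- by move=> m n mn; exact: subset_bigsetU.
- move=> x; have [n _ Kx] : (\bigcup_n K n) x by rewrite KT.
  by exists n.+1; rewrite -bigcup_mkord; exists n => /=.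
Qed.

(** The compact sets of an exhaustion have measures increasing to [1]. *)
Lemma sigma_compact_tight theta : sigma_compact S -> tight theta.
Proof.
move=> /sigma_compact_exhaustion [C [cC ndC CT]] eps eps0.
have mC n : measurable (C n : set (borel S)).
  apply: borel_closed; apply: compact_closed => //.
  exact: (@metric_hausdorff R S).
have : theta \o C @ \oo --> theta (\bigcup_n C n : set (borel S)).
  apply: nondecreasing_cvg_mu => //; first exact: bigcup_measurable.
  by move=> m n mn; apply/subsetPset; exact: ndC.
have -> : \bigcup_n C n = [set: borel S].
  by apply/seteqP; split => // x _; have [n Cx] := CT x; exists n.
rewrite probability_setT => theta1.
have [n _ nP] : \forall n \near \oo, ((1 - eps)%:E < theta (C n))%E.
  have h : ((1 - eps)%:E < 1 :> \bar R)%E by rewrite lte_fin gtrBl.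
  exact: (theta1 _ (open_ereal_gt' h)).
exists (C n) => //; rewrite probability_setC//.
rewrite lteBlDr// ?fin_num_measure// -lteBlDl// ?fin_num_measure//.
by rewrite -EFinB nP/=.
Qed.

(** Compactness is used in its near-covering form, along the filter of those
    families of sets that contain all large enough open null sets; it is a
    filter because the union of two null sets is null. *)
Lemma compact_null_cover theta K : compact K ->
  (forall x, K x -> exists U, [/\ open U, U x & theta U = 0%E]) ->
  exists U, [/\ open U, K `<=` U & theta U = 0%E].
Proof.
move=> /compact_near_coveringP Kcov Knull.
pose null V := open V /\ theta V = 0%E.
pose F : set_system (set S) :=
  [set A | exists2 V, null V & forall V', null V' -> V `<=` V' -> A V'].
have FF : Filter F.
  split.
  - by exists set0 => //; split; [exact: open0|exact: measure0].
  - move=> A B [V [oV V0] VA] [W [oW W0] WB]; exists (V `|` W).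
      split; first exact: openU.
      by rewrite measureU0//; exact: borel_open.
    move=> V' nV' VWV'; split; [apply: VA|apply: WB] => //;
      exact: (subset_trans _ VWV').
  - by move=> A B AB [V nV VA]; exists V => // V' nV' VV'; exact/AB/VA.
have [|V [oV V0] VK] := Kcov _ F (fun V x => V x) FF.
  move=> x /Knull[U [oU Ux U0]].
  exists (U, [set V | null V /\ U `<=` V]); first split => /=.
  - exact: open_nbhs_nbhs.
  - by exists U => //= V' ? ?.
  - by move=> [y V] /= [Uy [_ UV]]; exact: UV.
by exists V; split => //; exact: VK.
Qed.

(** [F n] consists of the points that no ball of radius [1/(n+1)] centred
    outside [U] reaches. *)
Lemma open_Fsigma U : open U ->
  exists F : (set S)^nat, (forall n, closed (F n)) /\ U = \bigcup_n F n.
Proof.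
move=> oU.
have r0 n : 0 < n.+1%:R^-1 :> R by rewrite invr_gt0.
pose r n := PosNum (r0 n).
exists (fun n => ~` \bigcup_(y in ~` U) (ball y (r n)%:num)°); split.
  by move=> n; apply/open_closedC/bigcup_open => y _; exact: open_interior.
apply/seteqP; split => x.
  move=> Ux; have /nbhs_ballP[e /= e0 eU] : nbhs x U by exact: open_nbhs_nbhs.
  have [n ne] : exists n, (r n)%:num < e.
    by have [n nP] := ltr_add_invr e0; exists n; rewrite add0r in nP.
  exists n => //= -[y /= Uy /interior_subset yx]; apply/Uy/eU.
  by apply/ball_sym; apply: le_ball yx; exact: ltW.
move=> [n _ /= xn]; apply: contrapT => Ux; apply: xn; exists x => //.
exact: (open_nbhs_ball x (r n)).2.
Qed.

Lemma measure_support_closed theta : closed (measure_support theta).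
Proof.
rewrite -openC openE => x /= /existsNP[U /not_implyP[oU /not_implyP[Ux U0]]].
apply: (@filterS _ _ _ U); last exact: open_nbhs_nbhs.
by move=> y Uy /(_ U oU Uy).
Qed.

(** The complement of the support is a union of open null sets, in general an
    uncountable one. It is also a countable union of compact sets, because it is
    an F-sigma in a sigma-compact space, and each of these is covered by
    finitely many open null sets. *)
Lemma measure_supportC_null theta : sigma_compact S ->
  theta (~` measure_support theta) = 0%E.
Proof.
move=> [C cC CT]; set W := ~` _.
have oW : open W by apply/closed_openC/measure_support_closed.
have [F [cF WF]] := open_Fsigma oW.
apply: measure_negligible; first exact: borel_open.
have -> : W = \bigcup_n \bigcup_m (C m `&` F n).
  rewrite {1}WF; apply/seteqP; split => x [n _].
    move=> Fx; exists n => //; have [m _ Cx] : (\bigcup_n C n) x by rewrite CT.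
    by exists m.
  by move=> [m _ [_ Fx]]; exists n.
apply: negligible_bigcup => n; apply: negligible_bigcup => m.
have [|x [_ Fx]|U [oU CU U0]] := @compact_null_cover theta (C m `&` F n).
- by apply: compact_closedI.
- have : W x by rewrite WF; exists n.
  move=> /existsNP[U /not_implyP[oU /not_implyP[Ux U0]]].
  exists U; split => //; apply/eqP; rewrite eq_le measure_ge0 andbT leNgt.
  exact/negP.
- by exists U; split => //; exact: borel_open.
Qed.

End borel_measures.

(** * The dyadic mixture of a sequence of probabilities *)

Section dyadic_mixture.
Context d (T : measurableType d) (R : realType).
Variable theta : (probability T R)^nat.
Local Open Scope ereal_scope.

Lemma dyadic_weight_subproof k : (0 <= 2 ^- k.+1 :> R)%R.
Proof. by rewrite invr_ge0 exprn_ge0. Qed.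

Definition dyadic_weight (k : nat) : {nonneg R} :=
  NngNum (dyadic_weight_subproof k).

Definition dyadic_mixture : set T -> \bar R :=
  mseries (fun k => mscale (dyadic_weight k) (theta k)) 0.

HB.instance Definition _ := Measure.on dyadic_mixture.

Lemma dyadic_weight_sum : \sum_(k <oo) (dyadic_weight k)%:num%:E = 1.
Proof.
have := @cvg_geometric_eseries_half R 1 0; rewrite expr0 divr1.
rewrite (_ : eseries _ = eseries (fun k => (dyadic_weight k)%:num%:E)).
  by move/cvg_lim; apply.
by congr eseries; apply/funext => k /=; rewrite addn1 div1r natrX.
Qed.

Lemma dyadic_weight_partial_sum m :
  (\sum_(0 <= k < m) (dyadic_weight k)%:num = 1 - 2 ^- m)%R.
Proof.
elim: m => [|m IH]; first by rewrite big_geq// expr0 invr1 subrr.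
rewrite big_nat_recr//= IH exprS invfM mulrC.
by rewrite {1}(splitr (2 ^- m)) opprD addrA subrK.
Qed.

Lemma dyadic_mixture_setT : dyadic_mixture [set: T] = 1.
Proof.
rewrite -dyadic_weight_sum /dyadic_mixture /= /mseries.
apply: eq_eseriesr => k _.
by rewrite -[RHS]mule1 -(probability_setT (theta k)).
Qed.

HB.instance Definition _ :=
  Measure_isProbability.Build d T R dyadic_mixture dyadic_mixture_setT.

Lemma integral_dyadic_mixture (f : T -> \bar R) :
  measurable_fun [set: T] f -> (forall x, 0 <= f x) ->
  \int[dyadic_mixture]_x f x =
  \sum_(k <oo) (dyadic_weight k)%:num%:E * \int[theta k]_x f x.
Proof.
move=> mf f0; rewrite ge0_integral_measure_series//; apply: eq_eseriesr => k _.
by rewrite ge0_integral_mscale.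
Qed.

(** The indices [k < m] have total weight [1 - 2^-m], and only they pay the
    extra error [b]. *)
Lemma le_integral_dyadic_mixture (f g : T -> \bar R) (m : nat) (a b : R) :
  measurable_fun [set: T] f -> (forall x, 0 <= f x) ->
  measurable_fun [set: T] g -> (forall x, 0 <= g x) ->
  (0 <= a)%R -> (0 <= b)%R ->
  (forall k, (k < m)%N ->
    \int[theta k]_x f x <= \int[theta k]_x g x + (a + b)%:E) ->
  (forall k, (m <= k)%N ->
    \int[theta k]_x f x <= \int[theta k]_x g x + a%:E) ->
  \int[dyadic_mixture]_x f x <=
  \int[dyadic_mixture]_x g x + (a + (1 - 2 ^- m) * b)%:E.
Proof.
move=> mf f0 mg g0 a0 b0 lt_m ge_m; rewrite !integral_dyadic_mixture//.
pose w k := (dyadic_weight k)%:num.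
have w0 k : (0 <= w k)%R by exact: dyadic_weight_subproof.
pose e k := if (k < m)%N then (w k * b)%:E else 0.
have e0 k : 0 <= e k by rewrite /e; case: ifP => // _; rewrite lee_fin mulr_ge0.
have sum_e : \sum_(k <oo) e k = ((1 - 2 ^- m) * b)%:E.
  rewrite (nneseries_split 0 m)// add0n eseries0 ?adde0; last first.
    by move=> k mk _; rewrite /e ltnNge mk.
  rewrite -dyadic_weight_partial_sum mulr_suml -sumEFin.
  by apply: eq_big_nat => k /andP[_ km]; rewrite /e km.
have sum_a : \sum_(k <oo) ((w k)%:E * a%:E) = a%:E.
  under eq_eseriesr do rewrite muleC.
  by rewrite nneseriesZl ?dyadic_weight_sum ?mule1// => k _; rewrite lee_fin.
rewrite EFinD -sum_e -[in leRHS]sum_a -nneseriesD//; last first.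
  by move=> k _ _; rewrite mule_ge0// lee_fin.
rewrite -nneseriesD//; last 2 first.
- by move=> k _ _; rewrite mule_ge0// ?lee_fin//; exact: integral_ge0.
- by move=> k _ _; rewrite adde_ge0// mule_ge0// lee_fin.
apply: lee_nneseries => k _.
  by rewrite mule_ge0// ?lee_fin//; exact: integral_ge0.
rewrite /e; case: ltnP => km.
- rewrite EFinM -muleDr// -ge0_muleDr//; last 2 first.
  + exact: integral_ge0.
  + by rewrite lee_fin addr_ge0.
  by rewrite lee_wpmul2l ?lee_fin// -EFinD lt_m.
- rewrite adde0 -ge0_muleDr//; last exact: integral_ge0.
  by rewrite lee_wpmul2l ?lee_fin// ge_m.
Qed.

End dyadic_mixture.

(** * Comparing a harmonic function at two points *)

Section harmonic_functions.
Context {R : realType} {S : metricMonoidType R}.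
Implicit Types (theta : probability (borel S) R) (g : S -> R).

(** [iter n (spread L) X] contains the products [x y_1 ... y_j] with [x] in [X],
    [j <= n] and all [y_i] in [L]: the points that a right random walk started
    in [X] may visit in [n] steps with increments in [L]. *)
Definition spread (L X : set S) : set S :=
  X `|` [set (p.1 * p.2)%g | p in X `*` L].

Lemma subset_iter_spread L X n : X `<=` iter n (spread L) X.
Proof. by elim: n => //= n IH x Xx; left; exact: IH. Qed.

Lemma iter_spreadS L X Y n :
  X `<=` Y -> iter n (spread L) X `<=` iter n (spread L) Y.
Proof.
move=> XY; elim: n => //= n IH x [/IH|[p [Xp Lp] <-]]; first by left.
by right; exists p => //; split => //; exact: IH.
Qed.

Lemma compact_iter_spread L X n :
  compact L -> compact X -> compact (iter n (spread L) X).
Proof.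
move=> cL cX; elim: n => //= n IH; apply: compactU => //.
apply: (@continuous_compact _ _ (fun p : S * S => (p.1 * p.2)%g)).
  by apply: continuous_subspaceT => p; exact: mulg_continuous.
exact: compact_setX.
Qed.

Lemma measurable_lmul g s : measurable_fun [set: borel S] (g : borel S -> R) ->
  measurable_fun [set: borel S] (fun y : borel S => g (s * (y : S))%g).
Proof. by move=> mg; exact: (measurableT_comp mg (lmul_measurable s)). Qed.

(** The factor [2] appears because both translates are compared with
    [\int g dtheta]. *)
Lemma le_integral_translate theta g (B e : R) s s' :
  measurable_fun [set: borel S] (g : borel S -> R) ->
  (forall x, 0 <= g x <= B) ->
  (tv_norm (translation_defect theta s) < e%:E)%E ->
  (tv_norm (translation_defect theta s') < e%:E)%E ->
  (\int[theta]_y (g (s * (y : S))%g)%:E <=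
   \int[theta]_y (g (s' * (y : S))%g)%:E + (2 * B * e)%:E)%E.
Proof.
move=> mg gB es es'.
have B0 : 0 <= B by case/andP: (gB 1%g) => /le_trans; exact.
have g0 y : (0 <= (g y)%:E)%E by rewrite lee_fin; case/andP: (gB y).
have bound t : (tv_norm (translation_defect theta t) < e%:E)%E ->
    (\int[theta]_y (g y)%:E <=
      \int[theta]_y (g (t * (y : S))%g)%:E + (B * e)%:E)%E /\
    (\int[theta]_y (g (t * (y : S))%g)%:E <=
      \int[theta]_y (g y)%:E + (B * e)%:E)%E.
  move=> te; have -> : (\int[theta]_y (g (t * (y : S))%g)%:E =
      \int[distribution theta (lmul t)]_y (g y)%:E)%E.
    rewrite ge0_integral_pushforward//; exact/measurable_EFinP.
  have tvB : (B%:E * tv_norm (translation_defect theta t) <= (B * e)%:E)%E.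
    by rewrite EFinM lee_wpmul2l ?lee_fin// ltW.
  have [] := @le_integral_tv_norm _ (borel S) R theta
    (distribution theta (lmul t)) (translation_defect theta t) g B.
  - by move=> A mA.
  - exact: mg.
  - exact: gB.
  by move=> h1 h2; split; [apply: (le_trans h1)|apply: (le_trans h2)];
    rewrite leeD2l.
apply: (le_trans (bound _ es).2).
have -> : (2 * B * e)%:E = ((B * e)%:E + (B * e)%:E)%E.
  by rewrite -EFinD -mulrA mulr_natl mulr2n.
by rewrite addeA leeD2r//; exact: (bound _ es').1.
Qed.

(** One more step of the walk multiplies the part of the error that comes from
    the crude bound [g <= B] by the weight [1 - 2^-m] of the indices below [m],
    for which the induction hypothesis applies at [x y] and [x' y]. The error
    [a] does not accumulate: it is incurred once, when an index [k >= m] is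
    drawn and the comparison stops. *)
Lemma harmonic_contraction (theta : (probability (borel S) R)^nat) g (B a : R)
    (L A : set S) (m : nat) :
  measurable_fun [set: borel S] (g : borel S -> R) ->
  (forall x, 0 <= g x <= B) ->
  (forall x,
    (g x)%:E = \int[dyadic_mixture theta]_y (g (x * (y : S))%g)%:E)%E ->
  0 <= a ->
  (forall k, (k < m)%N -> {ae theta k, forall y : borel S, L y}) ->
  (forall k x x', (m <= k)%N -> A x -> A x' ->
    (\int[theta k]_y (g (x * (y : S))%g)%:E <=
     \int[theta k]_y (g (x' * (y : S))%g)%:E + a%:E)%E) ->
  forall n X, iter n (spread L) X `<=` A ->
  forall x x', X x -> X x' -> g x <= g x' + a + (1 - 2 ^- m) ^+ n * B.
Proof.
move=> mg gB harm a0 aeL inv; elim=> [|n IH] X XA x x' Xx Xx'.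
  rewrite expr0 mul1r; case/andP: (gB x) => _ /le_trans; apply.
  by case/andP: (gB x') => ? _; rewrite lerDr addr_ge0.
have B0 : 0 <= B by case/andP: (gB 1%g) => /le_trans; exact.
have g0 y : (0 <= (g y)%:E)%E by rewrite lee_fin; case/andP: (gB y).
have mgE s : measurable_fun [set: borel S]
    (fun y : borel S => (g (s * (y : S))%g)%:E).
  by apply/measurable_EFinP; exact: measurable_lmul.
have p0 : 0 <= 1 - 2 ^- m :> R.
  by rewrite subr_ge0 invf_le1 ?exprn_gt0// exprn_ege1// ler1n.
have b0 : 0 <= (1 - 2 ^- m) ^+ n * B by rewrite mulr_ge0// exprn_ge0.
(* Now [le_integral_dyadic_mixture] applies with [b := (1 - 2^-m)^n B]. *)
rewrite exprS -mulrA -addrA -lee_fin EFinD !harm.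
apply: le_integral_dyadic_mixture => //; last first.
  move=> k mk; apply: inv => //; apply: XA;
    exact: (@subset_iter_spread L X n.+1).
move=> k km; have ab0 : 0 <= a + (1 - 2 ^- m) ^+ n * B by rewrite addr_ge0.
apply: (@le_trans _ _ (\int[theta k]_y ((g (x' * (y : S))%g)%:E +
    (a + (1 - 2 ^- m) ^+ n * B)%:E))%E).
  apply: ae_ge0_le_integral => //.
  - by move=> y _; rewrite adde_ge0.
  - exact: emeasurable_funD.
  apply: (@filterS _ _ (ae_filter_ringOfSetsType _) _ _ _ (aeL k km)) => y Ly _.
  rewrite -EFinD lee_fin addrA; apply: (IH (spread L X)).
  + by rewrite -iterSr.
  + by right; exists (x, y).
  + by right; exists (x', y).
rewrite ge0_integralD//.
rewrite (integral_cst _ measurableT) [X in (_ + _ * X)%E](_ : _ = 1%E) ?mule1//.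
exact: probability_setT.
Qed.

End harmonic_functions.

(** * A nested sequence of almost invariant measures *)

Section nested_Reiter_sequence.
Context {R : realType} {S : metricMonoidType R}.

Lemma exists_small_power (m : nat) (e : R) :
  0 < e -> exists n, (1 - 2 ^- m) ^+ n <= e :> R.
Proof.
move=> e0; have p1 : `|1 - 2 ^- m : R| < 1.
  rewrite ger0_norm ?ltrBlDr ?ltrDl ?invr_gt0 ?exprn_gt0//.
  by rewrite subr_ge0 invf_le1 ?exprn_gt0// exprn_ege1// ler1n.
have /cvgr0_norm_le/(_ _ e0)[n _ /(_ n (leqnn n)) nP] := cvg_expr p1.
by exists n; exact: le_trans (ler_norm _) nP.
Qed.

(** The set [K] to which Reiter's condition is applied at stage [m] depends on
    the measures chosen before, so the choice is made for all pairs [(m, K)] at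
    once. *)
Lemma Reiter_choice : Reiter_condition S ->
  exists th : nat -> set S -> probability (borel S) R,
    forall m K, compact K -> compact (measure_support (th m K)) /\
      forall s, K s ->
        (tv_norm (translation_defect (th m K) s) < (m.+1%:R^-1)%:E)%E.
Proof.
move=> reiter.
have /choice[th thP] : forall mK : nat * set S,
    exists theta : probability (borel S) R,
      compact mK.2 -> compact (measure_support theta) /\
      forall s, mK.2 s ->
        (tv_norm (translation_defect theta s) < (mK.1.+1%:R^-1)%:E)%E.
  move=> [m K] /=.
  have [cK|ncK] := pselect (compact K).
    have e0 : 0 < m.+1%:R^-1 :> R by rewrite invr_gt0.
    have [theta cs defect] := reiter _ K e0 cK.
    by exists theta.
  have [theta _ _] := reiter 1 set0 ltr01 (@compact0 S).
  by exists theta.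
by exists (fun m K => th (m, K)) => m K; exact: (thP (m, K)).
Qed.

(** [K m] is where [theta m] is almost invariant and [L m] is the union of the
    supports of the earlier measures. *)
Lemma exists_nested_Reiter_sequence : sigma_compact S -> Reiter_condition S ->
  exists (theta : (probability (borel S) R)^nat) (K L : (set S)^nat),
  [/\ forall m n, (m <= n)%N -> K m `<=` K n,
      forall m s, K m s ->
        (tv_norm (translation_defect (theta m) s) < (m.+1%:R^-1)%:E)%E,
      forall k m, (k < m)%N -> {ae theta k, forall y : borel S, L m y} &
      forall x x', exists m0, forall m, (m0 <= m)%N ->
        exists2 n, (1 - 2 ^- m) ^+ n <= m.+1%:R^-1 :> R &
          iter n (spread (L m)) [set x; x'] `<=` K m].
Proof.
move=> Ssc /Reiter_choice[th thP].
have [C [cC ndC CT]] := sigma_compact_exhaustion Ssc.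
have /choice[N NP] : forall m, exists n, (1 - 2 ^- m) ^+ n <= m.+1%:R^-1 :> R.
  by move=> m; apply: exists_small_power; rewrite invr_gt0.
(* [L m.+1] is fixed before [K m.+1], which has to absorb the walks with
   increments in [L m.+1]; the chosen measure [theta m] is [th m (K m)]. *)
pose step m (KL : set S * set S) :=
  let L := KL.2 `|` measure_support (th m KL.1) in
  (KL.1 `|` iter (N m.+1) (spread L) (C m.+1), L).
pose KL := fix KL m := if m is m'.+1 then step m' (KL m') else (set0, set0).
pose K m := (KL m).1; pose L m := (KL m).2; pose theta m := th m (K m).
have cKL m : compact (K m) /\ compact (L m).
  elim: m => [|m [cK cL]]; first by split; exact: compact0.
  have cL' : compact (L m.+1) by apply: compactU => //; case: (thP m _ cK).
  by split=> //; apply: compactU => //; exact: compact_iter_spread.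
have ndL k m : (k < m)%N -> measure_support (theta k) `<=` L m.
  elim: m => // m IH; rewrite ltnS leq_eqVlt => /predU1P[->|/IH kL].
    by move=> x; right.
  by move=> x /kL; left.
exists theta, K, L; split.
- move=> m n; elim: n => [|n IH]; first by rewrite leqn0 => /eqP ->.
  by rewrite leq_eqVlt => /predU1P[->//|/IH Kmn] x /Kmn; left.
- by move=> m s Ks; case: (thP m _ (cKL m).1) => _; exact.
- move=> k m km; exists (~` measure_support (theta k)); split.
  + by apply: measurableC; apply: borel_closed; exact: measure_support_closed.
  + exact: measure_supportC_null.
  + by apply: subsetC; exact: ndL.
- move=> x x'; have [i Ci] := CT x; have [j Cj] := CT x'.
  (* [K 0] is empty, hence the lower bound [1] on [m]. *)
  exists (maxn (maxn i j) 1) => -[|m]; first by rewrite geq_max andbF.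
  rewrite 2!geq_max -andbA => /and3P[im jm _]; exists (N m.+1); first exact: NP.
  apply: (@subset_trans _ (iter (N m.+1) (spread (L m.+1)) (C m.+1)));
    last by move=> y; right.
  by apply: iter_spreadS => y [->|->]; [exact: ndC Ci|exact: ndC Cj].
Qed.

(** The inequality suffices for constancy because [x] and [x'] can be exchanged.
    For large [m] it holds up to [3 B / (m+1)]: [2 B / (m+1)] from the almost
    invariance and [B / (m+1)] from the choice of the number of steps. *)
Lemma exists_Liouville_mixture : sigma_compact S -> Reiter_condition S ->
  exists theta : (probability (borel S) R)^nat, forall (g : S -> R) (B : R),
    measurable_fun [set: borel S] (g : borel S -> R) ->
    (forall x, 0 <= g x <= B) ->
    (forall x,
      (g x)%:E = \int[dyadic_mixture theta]_y (g (x * (y : S))%g)%:E)%E ->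
    forall x x', g x <= g x'.
Proof.
move=> Ssc /(exists_nested_Reiter_sequence Ssc).
move=> [theta [K [L [ndK Kinv aeL Kspread]]]]; exists theta.
move=> g B mg gB harm x x'.
have B0 : 0 <= B by case/andP: (gB 1%g) => /le_trans; exact.
have [m0 m0P] := Kspread x x'.
have bound m : (m0 <= m)%N -> g x <= g x' + 3 * B * m.+1%:R^-1.
  move=> /m0P[n pn XK].
  have a0 : 0 <= 2 * B * m.+1%:R^-1 by rewrite !mulr_ge0// invr_ge0.
  apply: le_trans (harmonic_contraction mg gB harm a0 (aeL^~ m) _ XK _ _) _.
  - move=> k y y' mk Ky Ky'; apply: le_trans (le_integral_translate mg gB
      (Kinv k y (ndK _ _ mk y Ky)) (Kinv k y' (ndK _ _ mk y' Ky'))) _.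
    rewrite leeD2l// lee_fin ler_wpM2l ?mulr_ge0// lef_pV2 ?posrE//.
    by rewrite ler_nat.
  - by left.
  - by right.
  have : (1 - 2 ^- m) ^+ n * B <= m.+1%:R^-1 * B by rewrite ler_wpM2r.
  have -> : 3 * B * m.+1%:R^-1 = 2 * B * m.+1%:R^-1 + m.+1%:R^-1 * B.
    by rewrite -!mulrA (mulrC _ B) -(natr1 2) mulrDl mul1r.
  by rewrite addrA lerD2l.
apply/ler_addgt0Pl => e e0.
have [k ke] : exists k : nat, 3 * B * k.+1%:R^-1 <= e.
  exists (Num.truncn (3 * B / e)); rewrite ler_pdivrMr//.
  by rewrite [leRHS]mulrC -ler_pdivrMr// ltW// truncnS_gt.
apply: le_trans (bound (maxn m0 k) (leq_maxl _ _)) _.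
rewrite addrC lerD2r; apply: le_trans ke.
rewrite ler_wpM2l ?mulr_ge0// lef_pV2 ?posrE// ler_nat ltnS.
exact: leq_maxr.
Qed.

End nested_Reiter_sequence.

(** * Harmonic functions with real and complex values *)

Section complex_valued.
Context {R : realType} {S : metricMonoidType R}.
Implicit Types (pi : probability (borel S) R) (f : S -> R[i]^o).

Lemma le_normr_Re_normc (z : R[i]) : `|complex.Re z| <= normc z.
Proof. by rewrite -lecR; exact: normc_ge_Re. Qed.

Lemma le_normr_Im_normc (z : R[i]) : `|complex.Im z| <= normc z.
Proof.
by case: z => a b; rewrite /= -sqrtr_sqr ler_wsqrtr// lerDr sqr_ge0.
Qed.

(** Meant for the real and imaginary parts: the topology of [R[i]^o] is that of
    the modulus, whose values lie in [R[i]] and not in [R]. *)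
Lemma continuous_of_le_normc (phi : {additive R[i] -> R}) f :
  (forall z, `|phi z| <= normc z) ->
  continuous f -> continuous (phi \o f : S -> R).
Proof.
move=> phi_le cf x; apply/cvgrPdist_lt => e e0.
have e0' : 0 < e%:C%C :> R[i] by rewrite ltcR.
have /cvgrPdist_lt/(_ _ e0') := cf x; apply: filterS => y fxy.
rewrite -raddfB; apply: le_lt_trans (phi_le _) _.
by rewrite -ltcR.
Qed.

Lemma bounded_integrable pi (u : S -> R) (M : R) :
  measurable_fun [set: borel S] (u : borel S -> R) ->
  (forall x, `|u x| <= M) ->
  pi.-integrable setT (EFin \o u : borel S -> \bar R).
Proof.
move=> mu uM; apply: measurable_bounded_integrable => //.
  by rewrite [X in (X < _)%E]probability_setT ltry.
exists M; split; first exact: num_real.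
by move=> N MN y _; exact: le_trans (uM y) (ltW MN).
Qed.

(** Adding the constant [M] makes [u] nonnegative and keeps it harmonic, since
    [pi] has mass [1]. *)
Lemma harmonic_eq_of_nonneg pi :
  (forall (g : S -> R) (B : R),
    measurable_fun [set: borel S] (g : borel S -> R) ->
    (forall x, 0 <= g x <= B) ->
    (forall x, (g x)%:E = \int[pi]_y (g (x * (y : S))%g)%:E)%E ->
    forall x x', g x <= g x') ->
  forall (u : S -> R) (M : R), continuous u -> (forall x, `|u x| <= M) ->
  (forall x, u x = \int[pi]_y u (x * (y : S))%g) -> forall x x', u x = u x'.
Proof.
move=> Liouville u M /continuous_borel_measurable mu uM harm.
suff le x x' : u x <= u x' by move=> x x'; apply/eqP; rewrite eq_le !le.
have mux t := measurable_lmul t mu.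
rewrite -(lerD2r M).
apply: (Liouville (fun y => u y + M) (2 * M)).
- exact: measurable_funD.
- move=> y; have := uM y; rewrite ler_norml => /andP[lo hi].
  by rewrite -lerBlDr sub0r lo mulr_natl mulr2n lerD2r.
- move=> t; have iu := @bounded_integrable pi _ M (mux t) (fun y => uM _).
  have -> : (\int[pi]_y (u (t * (y : S))%g + M)%:E =
      \int[pi]_y (u (t * (y : S))%g)%:E + \int[pi]_y (cst M%:E y))%E.
    rewrite -integralD_EFin//; exact: finite_measure_integrable_cst.
  rewrite (integral_cst _ measurableT) [X in (_ + _ * X)%E](_ : _ = 1%E);
    last exact: probability_setT.
  by rewrite mule1 EFinD harm /Rintegral fineK//; exact: integrable_fin_num.
Qed.

Lemma cst_harmonic pi (c : R[i]^o) : harmonic_LUC pi (cst c : S -> R[i]^o).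
Proof.
have Cbc : Cb (cst c : S -> R[i]^o).
  by split; [exact: cst_continuous|exists (normc c)].
split.
  split=> // a; rewrite (_ : (fun b => _) = cst 0); first exact: cvg_cst.
  apply/funext => b; rewrite /sup_norm -[RHS](@sup1 R); congr sup.
  apply/seteqP; split => [_ [y _ <-]|_ ->] /=.
    by rewrite /delta_conv/= subrr normc0.
  by exists 1%g => //; rewrite /delta_conv/= subrr normc0.
have integral_cst_pi (r : R) : \int[pi]_y r = r.
  rewrite Rintegral_cst// [X in _ * X](_ : _ = 1) ?mulr1//.
  exact: (congr1 fine (probability_setT pi)).
by move=> x; rewrite /cintegral /= !integral_cst_pi; case: c {Cbc}.
Qed.

End complex_valued.

Theorem theorem6p11 (R : realType) (S : metricMonoidType R)
    (S_sigma_compact : sigma_compact S) (S_Reiter : Reiter_condition S) :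
  Liouville_property S.
Proof.
have [theta thetaP] := exists_Liouville_mixture S_sigma_compact S_Reiter.
have constant := harmonic_eq_of_nonneg thetaP.
exists (dyadic_mixture theta); first exact: sigma_compact_tight.
apply/seteqP; split => [f [[[cf [M fM]] _ _] harm]|_ [c _ <-]]; last first.
  exact: cst_harmonic.
exists (f 1%g) => //; apply/funext => x /=.
have fRe : forall x y, complex.Re (f x) = complex.Re (f y).
  apply: (constant (fun x => complex.Re (f x)) M).
  - exact: (continuous_of_le_normc (@le_normr_Re_normc R) cf).
  - by move=> y; exact: le_trans (le_normr_Re_normc _) (fM y).
  - by move=> y; rewrite [in LHS]harm.
have fIm : forall x y, complex.Im (f x) = complex.Im (f y).
  apply: (constant (fun x => complex.Im (f x)) M).
  - exact: (continuous_of_le_normc (@le_normr_Im_normc R) cf).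
  - by move=> y; exact: le_trans (le_normr_Im_normc _) (fM y).
  - by move=> y; rewrite [in LHS]harm.
by apply/eqP; rewrite eq_complex (fRe x 1%g) (fIm x 1%g) !eqxx.
Qed.
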